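(* Let $a,b,c>0$. The length of the longest line segment that can move around the corner in the spatial corridor $\mathcal S_{03}$, $\mathcal S_{11}$, or $\mathcal S_{13}$ is $\big((a^{2/3}+b^{2/3})^{3}+c^2\big)^{1/2}$, whereas for the remaining five corridors $\mathcal S_{00},\mathcal S_{01},\mathcal S_{02},\mathcal S_{10},\mathcal S_{12}$ this can be done for a segment of arbitrary length.
   Context: Fix $a,b,c>0$. In the plane $\mathbb R^2$ with coordinates $(x,y)$ set $\mathcal D=\{x=a,\ 0<y<b\}$, $\mathcal A_0=\mathcal D\cup\{0<x<a\}$, $\mathcal B_0=\mathcal D\cup\{x>a\}$, $\mathcal A_1=\mathcal A_0\cap\{y>0\}$, $\mathcal B_1=\mathcal B_0\cap\{y>0\}$, $\mathcal B_2=\mathcal B_0\cap\{y<b\}$, $\mathcal B_3=\mathcal B_0\cap\{0<y<b\}$, and $\mathcal C_{ij}=\mathcal A_i\cup\mathcal B_j$ for $(i,j)\in\{0,1\}\times\{0,1,2,3\}$. The spatial corridors are $\mathcal S_{ij}=\mathcal C_{ij}\times(0,c)\subset\mathbb R^3$. Moving around the corner in $\mathcal S_{ij}$ is understood as in the planar case: a body or segment $I$ can move around the corner in $\mathcal S_{ij}$ if there is a continuous path $\Phi_t$, $t\in[0,1]$, of rigid motions of space such that $\Phi_0(I)\subset\mathcal A_i\times(0,c)$, $\Phi_1(I)\subset\mathcal B_j\times(0,c)$ and $\Phi_t(I)\subset\mathcal S_{ij}$ for all $t\in[0,1]$. *)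

(* Defs.v *)
From HB Require Import structures.
From mathcomp Require Import all_boot all_order all_algebra.
From mathcomp Require Import all_classical all_reals all_analysis.
Set Implicit Arguments.
Unset Strict Implicit.
Unset Printing Implicit Defensive.
Import Order.TTheory GRing.Theory Num.Theory.
Import numFieldNormedType.Exports.
Local Open Scope classical_set_scope.
Local Open Scope ring_scope.

Section Corridors.
Context {R : realType}.
Implicit Types (a b c : R) (p q : 'rV[R]_3).

Definition doorway a b : set (R * R) := [set z | z.1 = a /\ 0 < z.2 < b].

Definition planarA0 a b : set (R * R) := doorway a b `|` [set z | 0 < z.1 < a].
Definition planarA1 a b : set (R * R) := planarA0 a b `&` [set z | 0 < z.2].

Definition planarB0 a b : set (R * R) := doorway a b `|` [set z | a < z.1].
Definition planarB1 a b : set (R * R) := planarB0 a b `&` [set z | 0 < z.2].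
Definition planarB2 a b : set (R * R) := planarB0 a b `&` [set z | z.2 < b].
Definition planarB3 a b : set (R * R) := planarB0 a b `&` [set z | 0 < z.2 < b].

Definition planarA a b (i : 'I_2) : set (R * R) :=
  if val i is 0%N then planarA0 a b else planarA1 a b.

Definition planarB a b (j : 'I_4) : set (R * R) :=
  match val j with
  | 0%N => planarB0 a b
  | 1%N => planarB1 a b
  | 2%N => planarB2 a b
  | _ => planarB3 a b
  end.

Definition planar_corridor a b (i : 'I_2) (j : 'I_4) : set (R * R) :=
  planarA a b i `|` planarB a b j.

(* The product X * (0, c), with R^3 modelled by row vectors. *)
Definition prism (X : set (R * R)) c : set 'rV[R]_3 :=
  [set p | X (p 0 0, p 0 1) /\ 0 < p 0 2 < c].

Definition spatial_corridor a b c (i : 'I_2) (j : 'I_4) : set 'rV[R]_3 :=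
  prism (planar_corridor a b i j) c.

Definition rotation (Q : 'M[R]_3) : Prop := Q *m Q^T = 1%:M /\ \det Q = 1.

Definition rigid_motion (Q : 'M[R]_3) (v : 'rV[R]_3) p : 'rV[R]_3 :=
  p *m Q + v.

(* A continuous path of rigid motions is given by continuous rotation and
   translation parts. *)
Definition moves_around_corner a b c (i : 'I_2) (j : 'I_4)
    (I : set 'rV[R]_3) : Prop :=
  exists (Q : R -> 'M[R]_3) (v : R -> 'rV[R]_3),
    [/\ {within `[0, 1], continuous Q} /\ {within `[0, 1], continuous v},
        forall t : R, 0 <= t <= 1 -> rotation (Q t),
        rigid_motion (Q 0) (v 0) @` I `<=` prism (planarA a b i) c,
        rigid_motion (Q 1) (v 1) @` I `<=` prism (planarB a b j) c &
        forall t : R, 0 <= t <= 1 ->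
          rigid_motion (Q t) (v t) @` I `<=` spatial_corridor a b c i j].

Definition line_segment p q : set 'rV[R]_3 :=
  [set (1 - s) *: p + s *: q | s in `[0, 1]].

(* The library norm on row vectors is the sup norm, not the Euclidean one. *)
Definition euclidean_dist p q : R :=
  Num.sqrt (\sum_(k < 3) (p 0 k - q 0 k) ^+ 2).

Definition movable_segment_lengths a b c (i : 'I_2) (j : 'I_4) : set R :=
  [set l | exists p q, p != q /\ l = euclidean_dist p q /\
    moves_around_corner a b c i j (line_segment p q)].

(* The corridors are not closed, so the maximal length is not attained:
   the length of the longest segment is the supremum of the movable lengths. *)
Definition longest_segment_length a b c (i : 'I_2) (j : 'I_4) (L : R) : Prop :=
  has_sup (movable_segment_lengths a b c i j) /\
  sup (movable_segment_lengths a b c i j) = L.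

End Corridors.

(* Main.v *)
(* Put al = a^(1/3), be = b^(1/3), M^2 = al^2 + be^2, so that M^3 is the planar
   ladder length.  Project the segment to the (x, y)-plane; its height
   difference stays below c, so if its square length exceeds M^6 + c^2 then its
   planar length always exceeds M^3.  In S_03 such a segment is steeper than
   be / al at the start and flatter at the end, so at some time its slope is
   exactly be / al in absolute value; at that slope the part in the first half
   has k-length at most al^2 and the part in the second half at most be^2 (where
   the increments are al k and be k), which forces the planar length to be at
   most M^3.  In S_11 the same happens because otherwise the upper end would
   have to cross the wall.  Conversely, for 0 < k < 1 the segment with planar
   length k M^3 and height k c is rotated about a vertical axis, keeping its ends
   near the outer walls, and then pushed sideways.  In the remaining corridors a
   segment of any length is translated along its own direction through the
   centre of the door, where the direction is almost parallel to the wall. *)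
Require Import Defs.
From mathcomp Require Import all_boot all_order all_algebra.
From mathcomp Require Import all_classical all_reals all_analysis.
From mathcomp Require Import ring lra.
Import Order.TTheory GRing.Theory Num.Theory.
Import numFieldNormedType.Exports.
Local Open Scope classical_set_scope.
Local Open Scope ring_scope.
Set Implicit Arguments.
Unset Strict Implicit.
Unset Printing Implicit Defensive.

(** * Planar inequalities at and around the critical slope *)

Lemma cube_sum_sqr_ge (R : realDomainType) (al be : R) :
  al ^+ 4 * (al ^+ 2 + be ^+ 2) <= (al ^+ 2 + be ^+ 2) ^+ 3.
Proof.
rewrite -subr_ge0.
have -> : (al ^+ 2 + be ^+ 2) ^+ 3 - al ^+ 4 * (al ^+ 2 + be ^+ 2) =
  (al ^+ 2 + be ^+ 2) * (be ^+ 2 * (2 * al ^+ 2 + be ^+ 2)) by ring.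
have := sqr_ge0 al; have := sqr_ge0 be => ? ?.
by apply: mulr_ge0; [lra|apply: mulr_ge0 => //; lra].
Qed.

(** If [al * w <= be * u] held, then [u <= al ^+ 3] would give [w <= be * al ^+ 2], and the squared
    length would be at most [al ^+ 4 * (al ^+ 2 + be ^+ 2)]. With the two coordinates exchanged this
    serves for segments of height difference at most [be ^+ 3]. *)
Lemma narrow_slope (R : realDomainType) (al be u w : R) :
  0 < al -> 0 < be -> 0 <= u -> 0 <= w -> u <= al ^+ 3 ->
  (al ^+ 2 + be ^+ 2) ^+ 3 < u ^+ 2 + w ^+ 2 -> be * u < al * w.
Proof.
move=> al0 be0 u0 w0 ua; apply: contraTT; rewrite -!leNgt => h.
have wb : w <= be * al ^+ 2.
  rewrite -(ler_pM2l al0) (le_trans h)//.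
  have -> : al * (be * al ^+ 2) = be * al ^+ 3 by ring.
  by rewrite ler_pM2l.
apply: le_trans (cube_sum_sqr_ge al be).
have -> : al ^+ 4 * (al ^+ 2 + be ^+ 2) = (al ^+ 3) ^+ 2 + (be * al ^+ 2) ^+ 2.
  by ring.
by rewrite lerD// lerXn2r// nnegrE ?mulr_ge0 ?exprn_ge0 ?ltW.
Qed.

(** Here [s] is the fraction of the segment lying in the first half. With [u = al * k] and
    [w = be * k] the two bounds become [s * k <= al ^+ 2] and [(1 - s) * k <= be ^+ 2]; their sum
    bounds [k]. *)
Lemma critical_slope_bound (R : realFieldType) (al be u w s : R) :
  0 < al -> 0 < be -> 0 <= u -> be * u = al * w ->
  s * u <= al ^+ 3 -> (1 - s) * w <= be ^+ 3 ->
  u ^+ 2 + w ^+ 2 <= (al ^+ 2 + be ^+ 2) ^+ 3.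
Proof.
move=> al0 be0 u0 slope hu hw.
pose k := u / al.
have uE : u = al * k by rewrite /k mulrCA mulfV ?mulr1 ?gt_eqF.
have wE : w = be * k.
  by apply: (mulfI (lt0r_neq0 al0)); rewrite -slope uE; ring.
have k0 : 0 <= k by rewrite divr_ge0 // ltW.
have h1 : s * k <= al ^+ 2.
  by rewrite -(ler_pM2l al0) -exprS; apply: le_trans hu; rewrite uE mulrCA.
have h2 : (1 - s) * k <= be ^+ 2.
  by rewrite -(ler_pM2l be0) -exprS; apply: le_trans hw; rewrite wE mulrCA.
have kM : k <= al ^+ 2 + be ^+ 2 by lra.
have -> : u ^+ 2 + w ^+ 2 = (al ^+ 2 + be ^+ 2) * k ^+ 2 by rewrite uE wE; ring.
rewrite exprS ler_wpM2l ?addr_ge0 ?sqr_ge0//.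
by rewrite lerXn2r// nnegrE addr_ge0 ?sqr_ge0.
Qed.

Lemma straddling_bound (R : realFieldType) (al be x1 y1 x2 y2 : R) :
  0 < al -> 0 < be -> 0 <= x1 -> x1 <= al ^+ 3 -> al ^+ 3 < x2 ->
  be * `|x2 - x1| = al * `|y2 - y1| ->
  (forall s, 0 <= s <= 1 -> (1 - s) * x1 + s * x2 = al ^+ 3 ->
     `|y2 - ((1 - s) * y1 + s * y2)| <= be ^+ 3) ->
  (x2 - x1) ^+ 2 + (y2 - y1) ^+ 2 <= (al ^+ 2 + be ^+ 2) ^+ 3.
Proof.
move=> al0 be0 x10 x1a ax2 slope door.
have dx0 : 0 < x2 - x1 by lra.
have dxn : x2 - x1 != 0 by rewrite gt_eqF.
(* The parameter at which the segment crosses the line x = a. *)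
pose s := (al ^+ 3 - x1) / (x2 - x1).
have sdx : s * (x2 - x1) = al ^+ 3 - x1 by rewrite /s divfK.
have s01 : 0 <= s <= 1.
  by rewrite /s divr_ge0 ?ler_pdivrMr//=; lra.
have := door s s01.
have -> : (1 - s) * x1 + s * x2 = x1 + s * (x2 - x1) by ring.
rewrite sdx addrC subrK => /(_ erefl).
have -> : y2 - ((1 - s) * y1 + s * y2) = (1 - s) * (y2 - y1) by ring.
case/andP: s01 => s0 s1; rewrite normrM ger0_norm ?subr_ge0// => hw.
rewrite -[(x2 - x1) ^+ 2]real_normK ?num_real// -[(y2 - y1) ^+ 2]real_normK ?num_real//.
apply: (@critical_slope_bound _ _ _ _ _ s) => //.
by rewrite gtr0_norm// sdx; lra.
Qed.

(** The segment lies in the first half (fraction 1), in the second half (fraction 0), or straddles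
    the door line, where both the crossing point and the right end have heights between 0 and b. *)
Lemma critical_bound03 (R : realFieldType) (al be x1 y1 x2 y2 : R) :
  0 < al -> 0 < be -> be * `|x2 - x1| = al * `|y2 - y1| ->
  (forall s, 0 <= s <= 1 -> 0 < (1 - s) * x1 + s * x2 /\
     (al ^+ 3 <= (1 - s) * x1 + s * x2 ->
       0 < (1 - s) * y1 + s * y2 < be ^+ 3)) ->
  (x2 - x1) ^+ 2 + (y2 - y1) ^+ 2 <= (al ^+ 2 + be ^+ 2) ^+ 3.
Proof.
move=> al0 be0.
wlog x12 : x1 y1 x2 y2 / x1 <= x2 => [hw slope reg|].
  have [h|/ltW h] := leP x1 x2; first exact: hw.
  rewrite -[x2 - x1]opprB -[y2 - y1]opprB !sqrrN; apply: hw => //.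
    by rewrite distrC slope distrC.
  move=> s s01.
  have /reg : 0 <= 1 - s <= 1 by lra.
  by rewrite opprB [1 + _]addrC subrK ![s * _ + _]addrC.
move=> slope reg.
have [|x10 h1] := reg 0; first by lra.
have [|x20 h2] := reg 1; first by lra.
rewrite subr0 !mul1r !mul0r !addr0 in x10 h1.
rewrite subrr !mul1r !mul0r !add0r in x20 h2.
have [x2a|ax2] := leP x2 (al ^+ 3).
  rewrite -[(x2 - x1) ^+ 2]real_normK ?num_real// -[(y2 - y1) ^+ 2]real_normK ?num_real//.
  apply: (@critical_slope_bound _ _ _ _ _ 1) => //.
    by rewrite mul1r ger0_norm ?subr_ge0//; lra.
  by rewrite subrr mul0r exprn_ge0 ?ltW.
have /andP[y20 y2b] := h2 (ltW ax2).
have [ax1|x1a] := leP (al ^+ 3) x1.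
  have /andP[y10 y1b] := h1 ax1.
  rewrite -[(x2 - x1) ^+ 2]real_normK ?num_real// -[(y2 - y1) ^+ 2]real_normK ?num_real//.
  apply: (@critical_slope_bound _ _ _ _ _ 0) => //.
    by rewrite mul0r exprn_ge0 ?ltW.
  by rewrite subr0 mul1r ler_norml; apply/andP; split; lra.
apply: straddling_bound => //; [exact: ltW|exact: ltW|].
move=> s s01 Xa; have [_] := reg s s01.
by rewrite Xa lexx => /(_ isT) /andP[? ?]; rewrite ler_norml; apply/andP; split; lra.
Qed.

(** Heights in the second half are not bounded by b here. It is enough that the right end is the
    lower one: its height is positive and the crossing point lies below b, so the part beyond the
    door drops by less than b. *)
Lemma critical_bound11 (R : realFieldType) (al be x1 y1 x2 y2 : R) :
  0 < al -> 0 < be -> be * `|x2 - x1| = al * `|y2 - y1| ->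
  x1 <= al ^+ 3 -> y2 <= y1 ->
  (forall s, 0 <= s <= 1 -> [/\ 0 < (1 - s) * x1 + s * x2,
     0 < (1 - s) * y1 + s * y2 &
     (1 - s) * x1 + s * x2 = al ^+ 3 -> (1 - s) * y1 + s * y2 < be ^+ 3]) ->
  (x2 - x1) ^+ 2 + (y2 - y1) ^+ 2 <= (al ^+ 2 + be ^+ 2) ^+ 3.
Proof.
move=> al0 be0 slope x1a y21 reg.
have [|x10 y10 _] := reg 0; first by lra.
have [|x20 y20 _] := reg 1; first by lra.
rewrite subr0 !mul1r !mul0r !addr0 in x10 y10.
rewrite subrr !mul1r !mul0r !add0r in x20 y20.
have [x2a|ax2] := leP x2 (al ^+ 3).
  rewrite -[(x2 - x1) ^+ 2]real_normK ?num_real// -[(y2 - y1) ^+ 2]real_normK ?num_real//.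
  apply: (@critical_slope_bound _ _ _ _ _ 1) => //.
    by rewrite mul1r ler_norml; apply/andP; split; lra.
  by rewrite subrr mul0r exprn_ge0 ?ltW.
apply: straddling_bound => //; first exact: ltW.
move=> s s01 Xa; have [_ Y0 /(_ Xa) Yb] := reg s s01.
have h : y2 <= (1 - s) * y1 + s * y2.
  have -> : (1 - s) * y1 + s * y2 = y2 + (1 - s) * (y1 - y2) by ring.
  by case/andP: s01 => s0 s1; rewrite lerDl mulr_ge0 ?subr_ge0.
by rewrite ler_norml; apply/andP; split; lra.
Qed.

(** The ladder of length [M ^+ 3] with ends on the axes lies on the line x S + y C = M^3 C S. The
    inequality says that the corner (a, b) is on this line or on its far side from the origin. *)
Lemma ladder_ineq (R : realDomainType) (al be M C S : R) :
  0 <= al -> 0 <= be -> 0 <= M -> M ^+ 2 = al ^+ 2 + be ^+ 2 ->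
  0 <= C -> 0 <= S -> C ^+ 2 + S ^+ 2 = 1 ->
  M ^+ 3 * C * S <= al ^+ 3 * S + be ^+ 3 * C.
Proof.
move=> al0 be0 M0 M2 C0 S0 CS.
(* Jensen by tangent: each term is bounded at its equality point M C = al,
   resp. M S = be. *)
have tangent (u v : R) : 0 <= u -> 0 <= v -> 3 * u ^+ 2 * v - v ^+ 3 <= 2 * u ^+ 3.
  move=> u0 v0; rewrite -subr_ge0.
  have -> : 2 * u ^+ 3 - (3 * u ^+ 2 * v - v ^+ 3) = (u - v) ^+ 2 * (2 * u + v) by ring.
  by rewrite mulr_ge0 ?sqr_ge0 // addr_ge0 // mulr_ge0.
have hC := ler_wpM2r S0 (tangent _ _ al0 (mulr_ge0 M0 C0)).
have hS := ler_wpM2r C0 (tangent _ _ be0 (mulr_ge0 M0 S0)).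
have h := lerD hC hS.
have e : (3 * al ^+ 2 * (M * C) - (M * C) ^+ 3) * S +
    (3 * be ^+ 2 * (M * S) - (M * S) ^+ 3) * C =
    2 * (M ^+ 3 * C * S).
  transitivity (3 * M * C * S * (al ^+ 2 + be ^+ 2) -
    M ^+ 3 * C * S * (C ^+ 2 + S ^+ 2)); first by ring.
  by rewrite CS -M2; ring.
lra.
Qed.

(** * Rotations of three-dimensional space *)

Lemma ord3_ind (P : 'I_3 -> Prop) : P 0 -> P 1 -> P 2 -> forall i, P i.
Proof.
move=> P0 P1 P2 [[|[|[|//]]] h].
- by have <- : 0 = Ordinal h by exact: val_inj.
- by have <- : 1 = Ordinal h by exact: val_inj.
- by have <- : 2 = Ordinal h by exact: val_inj.
Qed.

Lemma sum_ord3 (V : nmodType) (F : 'I_3 -> V) : \sum_k F k = F 0 + F 1 + F 2.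
Proof.
rewrite !big_ord_recl big_ord0 addr0 addrA.
by congr (_ + F _ + F _); exact: val_inj.
Qed.

Lemma det3 (R : comPzRingType) (M : 'M[R]_3) :
  \det M = M 0 0 * (M 1 1 * M 2 2 - M 1 2 * M 2 1)
         - M 0 1 * (M 1 0 * M 2 2 - M 1 2 * M 2 0)
         + M 0 2 * (M 1 0 * M 2 1 - M 1 1 * M 2 0).
Proof.
rewrite (expand_det_row _ 0) !big_ord_recl big_ord0 /cofactor.
rewrite !(expand_det_row _ 0) !big_ord_recl !big_ord0 /cofactor !det_mx11 !mxE /=.
(* Indexing the entries by natural numbers lets the shifted ordinals of the minors compute. *)
pose f k l := M (inord k) (inord l).
have E i j : M i j = f i j by rewrite /f !inord_val.
rewrite !E /= /bump /= !addn0; ring.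
Qed.

(** The half turn about the bisector w = d + e exchanges two vectors of equal length. Its matrix is
    2 w^T w / |w|^2 - 1, of determinant 1 in dimension three. *)
Lemma half_turn (R : realType) (d e : 'rV[R]_3) :
  \sum_k d 0 k ^+ 2 = \sum_k e 0 k ^+ 2 -> d + e != 0 ->
  exists2 Q : 'M[R]_3, rotation Q & d *m Q = e.
Proof.
move=> de w0.
pose w k : R := d 0 k + e 0 k.
pose N := w 0 ^+ 2 + w 1 ^+ 2 + w 2 ^+ 2.
have N0 : N != 0.
  apply: contra w0 => /eqP /eqP; rewrite !paddr_eq0 ?addr_ge0 ?sqr_ge0// !sqrf_eq0.
  move=> /andP[/andP[/eqP w0 /eqP w1] /eqP w2].
  by apply/eqP/matrixP => i j; rewrite ord1 !mxE; elim/ord3_ind : j.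
(* Equality of the lengths enters here: |d + e|^2 is twice the inner product of d and d + e. *)
have Ndw : N = 2 * (d 0 0 * w 0 + d 0 1 * w 1 + d 0 2 * w 2).
  by move: de; rewrite !sum_ord3 /N /w => de; nra.
exists (\matrix_(i, j) (2 * w i * w j / N - (i == j)%:R)).
  split.
    apply/matrixP => i j; rewrite !mxE sum_ord3 !mxE.
    move: N0; rewrite /N.
    elim/ord3_ind : i; elim/ord3_ind : j => /= N0; field => //.
  rewrite det3 !mxE /=.
  move: N0; rewrite /N => N0; field => //.
apply/matrixP => i j; rewrite ord1 !mxE sum_ord3 !mxE.
have -> : e 0 j = w j - d 0 j by rewrite /w addrAC subrr add0r.
have -> : d 0 0 * (2 * w 0 * w j / N - (0 == j)%:R) +
  d 0 1 * (2 * w 1 * w j / N - (1 == j)%:R) +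
  d 0 2 * (2 * w 2 * w j / N - (2 == j)%:R) =
  (2 * (d 0 0 * w 0 + d 0 1 * w 1 + d 0 2 * w 2)) / N * w j -
  (d 0 0 * (0 == j)%:R + d 0 1 * (1 == j)%:R + d 0 2 * (2 == j)%:R).
  field => //.
rewrite -Ndw divff// mul1r; congr (_ - _).
by elim/ord3_ind : j => /=; ring.
Qed.

(** For opposite vectors the bisector vanishes, and the identity already sends [d] to [- e]. Either
    sign will do for a segment, whose ends may be exchanged. *)
Lemma rotation_align (R : realType) (d e : 'rV[R]_3) :
  \sum_k d 0 k ^+ 2 = \sum_k e 0 k ^+ 2 ->
  exists2 Q : 'M[R]_3, rotation Q & d *m Q = e \/ d *m Q = - e.
Proof.
move=> de; have [de0|/(half_turn de)[Q rQ dQ]] := eqVneq (d + e) 0; last first.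
  by exists Q => //; left.
exists 1%:M; first by split; rewrite ?det1// trmx1 mulmx1.
by right; rewrite mulmx1; apply/eqP; rewrite -addr_eq0 de0.
Qed.

Lemma rotation_sqnorm (R : realType) (Q : 'M[R]_3) (d : 'rV[R]_3) : rotation Q ->
  \sum_k (d *m Q) 0 k ^+ 2 = \sum_k d 0 k ^+ 2.
Proof.
move=> [QQ _].
have E (e : 'rV[R]_3) : \sum_k e 0 k ^+ 2 = (e *m e^T) 0 0.
  by rewrite mxE; apply: eq_bigr => k _; rewrite mxE expr2.
by rewrite !E trmx_mul mulmxA -(mulmxA d) QQ mulmx1.
Qed.

(** * Continuity of matrix-valued paths *)

Lemma mx_continuous (R : realType) (T : topologicalType) m n (f : T -> 'M[R]_(m, n)) :
  (forall i j, continuous (fun x => f x i j)) -> continuous f.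
Proof.
move=> fc x; apply/cvg_ballP => e e0.
have h : \forall y \near x, forall i j, ball (f x i j) e (f y i j).
  apply: filter_forall => i; apply: filter_forall => j.
  by have /cvg_ballP := fc i j x; apply.
by near=> y; split=> // i j; move: i j; near: y.
Unshelve. all: by end_near. Qed.

Lemma within_continuous_coord (R : realType) (T : topologicalType) (A : set T) m n
    (f : T -> 'M[R]_(m, n)) i j :
  {within A, continuous f} -> {within A, continuous (fun x => f x i j)}.
Proof.
move=> fc; apply: (@within_continuous_comp _ _ _ A f (fun M : 'M[R]_(m, n) => M i j)) fc.
by move=> M _; exact: coord_continuous.
Qed.

Lemma within_continuous_rigid_motion (R : realType) (A : set R) (Q : R -> 'M[R]_3)
    (v : R -> 'rV[R]_3) (p : 'rV[R]_3) :
  {within A, continuous Q} -> {within A, continuous v} ->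
  {within A, continuous (fun t => rigid_motion (Q t) (v t) p)}.
Proof.
move=> Qc vc; apply: within_continuousD => //.
apply: (@within_continuous_comp _ _ _ A Q (fun M : 'M[R]_3 => p *m M)) Qc.
move=> M _; apply: mx_continuous => i j.
have -> : (fun M : 'M[R]_3 => (p *m M) i j) = (fun M : 'M[R]_3 =>
    p i 0 * M 0 j + p i 1 * M 1 j + p i 2 * M 2 j).
  by apply/funext => N; rewrite mxE sum_ord3.
have c k : continuous (fun M : 'M[R]_3 => p i k * M k j).
  by move=> N; apply: (@continuousM _ _ (fun=> p i k)) => //;
    [exact: cst_continuous|exact: coord_continuous].
move=> N; apply: (@continuousD _ _ _ _ (fun M : 'M[R]_3 => p i 2 * M 2 j)); last exact: c.
by apply: continuousD; exact: c.
Qed.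

Lemma within_continuous_scale_norm (R : realType) (A : set R) (k : R) (f g : R -> R) :
  {within A, continuous f} -> {within A, continuous g} ->
  {within A, continuous (fun t => k * `|f t - g t|)}.
Proof.
move=> fc gc.
apply: (@within_continuous_comp _ _ _ A (f - g) (fun y : R => k * `|y|)).
  by move=> y _; apply: continuousM; [exact: cst_continuous|exact: norm_continuous].
exact: within_continuousB.
Qed.

(** * Existence of a time at which the slope is critical *)

Lemma critical_time03 (R : realType) (al be : R) (x1 y1 x2 y2 : R -> R) :
  0 < al -> 0 < be ->
  {within `[0, 1], continuous x1} -> {within `[0, 1], continuous y1} ->
  {within `[0, 1], continuous x2} -> {within `[0, 1], continuous y2} ->
  `|x2 0 - x1 0| <= al ^+ 3 -> `|y2 1 - y1 1| <= be ^+ 3 ->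
  (forall t s, 0 <= t <= 1 -> 0 <= s <= 1 ->
     0 < (1 - s) * x1 t + s * x2 t /\
     (al ^+ 3 <= (1 - s) * x1 t + s * x2 t ->
       0 < (1 - s) * y1 t + s * y2 t < be ^+ 3)) ->
  exists2 t, 0 <= t <= 1 &
    (x2 t - x1 t) ^+ 2 + (y2 t - y1 t) ^+ 2 <= (al ^+ 2 + be ^+ 2) ^+ 3.
Proof.
move=> al0 be0 cx1 cy1 cx2 cy2 start stop reg.
apply: contrapT => long.
have {}long t : 0 <= t <= 1 ->
    (al ^+ 2 + be ^+ 2) ^+ 3 < `|x2 t - x1 t| ^+ 2 + `|y2 t - y1 t| ^+ 2.
  move=> t01; rewrite !real_normK ?num_real// ltNge; apply/negP => h.
  by apply: long; exists t.
(* [F] is nonpositive at slopes steeper than [be / al] and nonnegative at flatter ones, so the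
   intermediate value theorem yields a time of critical slope. *)
pose F t := be * `|x2 t - x1 t| - al * `|y2 t - y1 t|.
have Fc : {within `[0, 1], continuous F}.
  by apply: (@within_continuousB _ _ _ _ (fun t => be * `|x2 t - x1 t|)
    (fun t => al * `|y2 t - y1 t|)); exact: within_continuous_scale_norm.
have F0 : F 0 <= 0.
  by rewrite subr_le0 ltW// narrow_slope// long// lexx ler01.
have F1 : 0 <= F 1.
  rewrite subr_ge0 ltW// narrow_slope//.
  by rewrite [be ^+ 2 + _]addrC [_ ^+ 2 + `|x2 1 - _| ^+ 2]addrC long// lexx ler01.
have [||t] := @IVT _ F 0 1 0 _ Fc; first exact: ler01.
  by rewrite ge_min le_max F0 F1 orbT.
rewrite in_itv/= => t01 /eqP; rewrite subr_eq0 => /eqP slope.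
have := long t t01; rewrite !real_normK ?num_real// ltNge => /negP; apply.
by apply: critical_bound03 => // s; exact: reg.
Qed.

(* The upper end of the segment cannot pass over the wall x = a, y >= b, so it
   stays in the first half until the critical slope is reached. *)
Lemma critical_time11 (R : realType) (al be : R) (x1 y1 x2 y2 : R -> R) :
  0 < al -> 0 < be ->
  {within `[0, 1], continuous x1} -> {within `[0, 1], continuous y1} ->
  {within `[0, 1], continuous x2} -> {within `[0, 1], continuous y2} ->
  x1 0 <= al ^+ 3 -> x2 0 <= al ^+ 3 -> al ^+ 3 <= x1 1 -> al ^+ 3 <= x2 1 ->
  (forall t s, 0 <= t <= 1 -> 0 <= s <= 1 ->
     [/\ 0 < (1 - s) * x1 t + s * x2 t, 0 < (1 - s) * y1 t + s * y2 t &
     (1 - s) * x1 t + s * x2 t = al ^+ 3 -> (1 - s) * y1 t + s * y2 t < be ^+ 3]) ->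
  exists2 t, 0 <= t <= 1 &
    (x2 t - x1 t) ^+ 2 + (y2 t - y1 t) ^+ 2 <= (al ^+ 2 + be ^+ 2) ^+ 3.
Proof.
move=> al0 be0.
(* By symmetry the first end is the upper one at time 0. *)
wlog y21 : x1 y1 x2 y2 / y2 0 <= y1 0 => [hw cx1 cy1 cx2 cy2 sx1 sx2 ex1 ex2 reg|].
  have [h|/ltW h] := leP (y2 0) (y1 0); first exact: hw.
  have [|t t01 ht] := hw x2 y2 x1 y1 h cx2 cy2 cx1 cy1 sx2 sx1 ex2 ex1.
    move=> t s t01 s01.
    have /(reg _ _ t01) : 0 <= 1 - s <= 1 by lra.
    by rewrite opprB [1 + _]addrC subrK ![s * _ + _]addrC.
  exists t => //.
  by rewrite -[x2 t - _]opprB -[y2 t - _]opprB !sqrrN.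
move=> cx1 cy1 cx2 cy2 sx1 sx2 ex1 ex2 reg.
apply: contrapT => long.
have {}long t : 0 <= t <= 1 ->
    (al ^+ 2 + be ^+ 2) ^+ 3 < `|x2 t - x1 t| ^+ 2 + `|y2 t - y1 t| ^+ 2.
  move=> t01; rewrite !real_normK ?num_real// ltNge; apply/negP => h.
  by apply: long; exists t.
have ends t (t01 : 0 <= t <= 1) :
    [/\ 0 < x1 t, 0 < x2 t, 0 < y2 t & x1 t = al ^+ 3 -> y1 t < be ^+ 3].
  have [|x10 _ door] := reg t 0 t01; first by rewrite lexx ler01.
  have [|x20 y20 _] := reg t 1 t01; first by rewrite lexx ler01.
  rewrite subr0 !mul1r !mul0r !addr0 in x10 door.
  by rewrite subrr !mul1r !mul0r !add0r in x20 y20.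
(* While the segment is at least critically steep with its first end on top, its height difference
   exceeds b. That end is then above the door and cannot lie on x = a, which is [notdoor]. *)
have high t : 0 <= t <= 1 -> be * `|x2 t - x1 t| <= al * (y1 t - y2 t) ->
    be ^+ 3 < y1 t - y2 t.
  move=> t01 h.
  have w0 : 0 <= y1 t - y2 t.
    by rewrite -(pmulr_rge0 _ al0) (le_trans _ h)// mulr_ge0// ltW.
  rewrite ltNge; apply/negP => wb.
  have L : (be ^+ 2 + al ^+ 2) ^+ 3 < (y1 t - y2 t) ^+ 2 + `|x2 t - x1 t| ^+ 2.
    by rewrite [be ^+ 2 + _]addrC [ltRHS]addrC -(ger0_norm w0) [`|y1 t - _|]distrC long.
  by have := narrow_slope be0 al0 w0 (normr_ge0 _) wb L; rewrite ltNge h.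
have notdoor t : 0 <= t <= 1 -> be * `|x2 t - x1 t| <= al * (y1 t - y2 t) ->
    x1 t != al ^+ 3.
  move=> t01 /(high _ t01) h; have [_ _ y20 door] := ends t t01.
  by apply/negP => /eqP /door; lra.
(* The height difference enters with its sign, so [0 <= G t] also keeps the first end on top. At a
   zero of the minimum [F] both terms are nonnegative and one vanishes; [notdoor] excludes the
   second, leaving [G t = 0] with the first end still in the first half. *)
pose G t := al * (y1 t - y2 t) - be * `|x2 t - x1 t|.
pose F := G \min (fun t => al ^+ 3 - x1 t).
have Gc : {within `[0, 1], continuous G}.
  apply: (@within_continuousB _ _ _ _ (fun t => al * (y1 t - y2 t))
    (fun t => be * `|x2 t - x1 t|)); last exact: within_continuous_scale_norm.
  apply: (@within_continuous_comp _ _ _ _ (y1 - y2) ( *%R al)).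
    by move=> y _; exact: mulrl_continuous.
  exact: within_continuousB.
have Fc : {within `[0, 1], continuous F}.
  move=> x; apply: continuous_min; first exact: Gc.
  apply: (@within_continuousB _ _ _ _ (fun=> al ^+ 3) x1) => //.
  by apply: continuous_subspaceT => ?; exact: cst_continuous.
have F0 : 0 <= F 0.
  rewrite /F /= le_min [0 <= _ - x1 0]subr_ge0 sx1 andbT /G.
  have t01 : 0 <= (0 : R) <= 1 by rewrite lexx ler01.
  have L := long 0 t01; have [x10 x20 _ _] := ends 0 t01.
  have W : `|y2 0 - y1 0| = y1 0 - y2 0 by rewrite distrC ger0_norm ?subr_ge0.
  rewrite W in L; rewrite subr_ge0 ltW// narrow_slope ?subr_ge0//.
  by rewrite ler_norml; apply/andP; split; lra.
have F1 : F 1 <= 0 by rewrite /F /= ge_min [_ - x1 1 <= 0]subr_le0 ex1 orbT.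
have [||t] := @IVT _ F 0 1 0 _ Fc; first exact: ler01.
  by rewrite ge_min le_max F0 F1 orbT.
rewrite in_itv/= => t01 Ft.
have : 0 <= F t by rewrite Ft.
rewrite /F /= le_min !subr_ge0 => /andP[slope x1a].
have /eqP x1n := notdoor t t01 slope.
have hi := high t t01 slope.
have Gt : G t = 0.
  move: Ft; rewrite /F /=; case: leP => // _ /eqP.
  by rewrite subr_eq0 => /eqP/esym.
have := long t t01; rewrite !real_normK ?num_real// ltNge => /negP; apply.
have b30 : 0 < be ^+ 3 by rewrite exprn_gt0.
apply: critical_bound11 => //.
- rewrite [`|y2 t - _|]distrC [`|y1 t - _|]ger0_norm; last by lra.
  by apply/esym/eqP; rewrite -subr_eq0; apply/eqP.
- lra.
- by move=> s; exact: reg.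
Qed.

(** * Corridor inclusions and the upper bound on the length *)

Lemma moves_around_corner_mono (R : realType) (a b c : R) (i i' : 'I_2) (j j' : 'I_4) I :
  planarA a b i `<=` planarA a b i' -> planarB a b j `<=` planarB a b j' ->
  moves_around_corner a b c i j I -> moves_around_corner a b c i' j' I.
Proof.
move=> AA BB [Q [v [QVc Qr h0 h1 ht]]]; exists Q, v; split => //.
- by move=> p /h0[/AA].
- by move=> p /h1[/BB].
by move=> t t01 p /(ht _ t01)[[/AA|/BB] ? ?]; split => //; [left|right].
Qed.

Lemma planarA_mono (R : realType) (a b : R) (i i' : 'I_2) :
  (i' <= i)%N -> planarA a b i `<=` planarA a b i'.
Proof.
case: i => [[|[|//]] hi]; case: i' => [[|[|//]] hi'] //= _ z; rewrite /planarA//=.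
by case.
Qed.

Lemma corridor03 (R : realType) (a b : R) (i : 'I_2) (j : 'I_4) (x y : R) :
  0 < a -> val i = 0%N -> val j = 3%N -> planar_corridor a b i j (x, y) ->
  0 < x /\ (a <= x -> 0 < y < b).
Proof.
rewrite /planar_corridor /planarA /planarB => a0 -> -> [[]|[]] /=.
- by move=> [/= -> ?]; split.
- by move=> /andP[x0 xa]; split => // ax; move: xa; rewrite ltNge ax.
by move=> [[/= -> _]|/= ax] ?; split => //; exact: lt_trans ax.
Qed.

Lemma corridor11 (R : realType) (a b : R) (i : 'I_2) (j : 'I_4) (x y : R) :
  0 < a -> val i = 1%N -> val j = 1%N -> planar_corridor a b i j (x, y) ->
  [/\ 0 < x, 0 < y & x = a -> y < b].
Proof.
rewrite /planar_corridor /planarA /planarB => a0 -> -> [[]|[]] /=.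
- move=> [[/= -> /andP[_ ?]]|/= /andP[x0 xa]] ?; split => // xE.
  by move: xa; rewrite xE ltxx.
- move=> [[/= -> /andP[_ ?]]|/= ax] ?; split => //; first exact: lt_trans ax.
  by move=> xE; move: ax; rewrite xE ltxx.
Qed.

Lemma planarA_le (R : realType) (a b : R) (i : 'I_2) (x y : R) :
  planarA a b i (x, y) -> x <= a.
Proof.
rewrite /planarA; case: (val i) => [|_ []]; by case=> [[/= ->]|/= /andP[_ /ltW]].
Qed.

Lemma planarB_ge (R : realType) (a b : R) (j : 'I_4) (x y : R) :
  planarB a b j (x, y) -> a <= x.
Proof.
by rewrite /planarB; case: (val j) => [|[|[|?]]]; do ?[case=> + _]; case=> [[/= ->]|/= /ltW].
Qed.

Lemma rigid_motion_segment (R : realType) (Q : 'M[R]_3) (v p q : 'rV[R]_3) (s : R) k :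
  rigid_motion Q v ((1 - s) *: p + s *: q) 0 k =
  (1 - s) * rigid_motion Q v p 0 k + s * rigid_motion Q v q 0 k.
Proof. by rewrite /rigid_motion mulmxDl -!scalemxAl !mxE; ring. Qed.

(** The squared length is constant along the motion, so it may be evaluated at the critical time:
    the planar part is then bounded, and the height contributes at most [c ^+ 2]. The pair (1, 3)
    will follow by inclusion. *)
Lemma movable_length_sqr_le (R : realType) (al be c : R) (i : 'I_2) (j : 'I_4) (l : R) :
  0 < al -> 0 < be -> (val i, val j) \in [:: (0, 3); (1, 1)]%N ->
  movable_segment_lengths (al ^+ 3) (be ^+ 3) c i j l ->
  l ^+ 2 <= (al ^+ 2 + be ^+ 2) ^+ 3 + c ^+ 2.
Proof.
move=> al0 be0 ij [p [q [_ [-> [Q [v [[Qc vc] Qr h0 h1 ht]]]]]]].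
rewrite sqr_sqrtr ?sumr_ge0// => [|k _]; last exact: sqr_ge0.
pose P t := rigid_motion (Q t) (v t) p; pose P' t := rigid_motion (Q t) (v t) q.
have Pc k : {within `[0, 1], continuous (fun t => P t 0 k)}.
  by apply: within_continuous_coord; exact: within_continuous_rigid_motion.
have P'c k : {within `[0, 1], continuous (fun t => P' t 0 k)}.
  by apply: within_continuous_coord; exact: within_continuous_rigid_motion.
have seg (X : set 'rV[R]_3) t : rigid_motion (Q t) (v t) @` line_segment p q `<=` X ->
    forall s, 0 <= s <= 1 -> X (rigid_motion (Q t) (v t) ((1 - s) *: p + s *: q)).
  move=> sub s s01; apply: sub; exists ((1 - s) *: p + s *: q) => //.
  by exists s => //=; rewrite in_itv.
have segP (X : set 'rV[R]_3) t : rigid_motion (Q t) (v t) @` line_segment p q `<=` X ->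
    X (P t) /\ X (P' t).
  move=> /seg sub; split.
    by have := sub 0; rewrite subr0 scale1r scale0r addr0 lexx ler01; apply.
  by have := sub 1; rewrite subrr scale1r scale0r add0r lexx ler01; apply.
have [t t01 planar] : exists2 t, 0 <= t <= 1 &
    (P' t 0 0 - P t 0 0) ^+ 2 + (P' t 0 1 - P t 0 1) ^+ 2 <= (al ^+ 2 + be ^+ 2) ^+ 3.
  have a30 : 0 < al ^+ 3 by rewrite exprn_gt0.
  have [[A0 _] [A0' _]] := segP _ _ h0; have [[B1 _] [B1' _]] := segP _ _ h1.
  move: ij; rewrite !inE => /orP[] /eqP[iE jE].
    apply: critical_time03 => //.
    - have [|P0 _] := @corridor03 _ _ (be ^+ 3) i j (P 0 0 0) (P 0 0 1) a30 iE jE.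
        by left.
      have [|P0' _] := @corridor03 _ _ (be ^+ 3) i j (P' 0 0 0) (P' 0 0 1) a30 iE jE.
        by left.
      have := planarA_le A0; have := planarA_le A0' => ? ?.
      by rewrite ler_norml; apply/andP; split; lra.
    - have [|_ ] := @corridor03 _ _ (be ^+ 3) i j (P 1 0 0) (P 1 0 1) a30 iE jE.
        by right.
      have [|_ ] := @corridor03 _ _ (be ^+ 3) i j (P' 1 0 0) (P' 1 0 1) a30 iE jE.
        by right.
      move=> /(_ (planarB_ge B1'))/andP[? ?] /(_ (planarB_ge B1))/andP[? ?].
      by rewrite ler_norml; apply/andP; split; lra.
    - move=> t s t01 s01.
      have [/(corridor03 a30 iE jE) + _] := seg _ _ (ht t t01) s s01.
      by rewrite !rigid_motion_segment.
  apply: critical_time11 => //;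
    [exact: planarA_le A0|exact: planarA_le A0'|exact: planarB_ge B1|
     exact: planarB_ge B1'|].
  move=> t s t01 s01.
  have [/(corridor11 a30 iE jE) + _] := seg _ _ (ht t t01) s s01.
  by rewrite !rigid_motion_segment.
have [[_ /andP[z0 zc]] [_ /andP[z0' zc']]] := segP _ _ (ht t t01).
have -> : \sum_(k < 3) (p 0 k - q 0 k) ^+ 2 = \sum_k (P' t 0 k - P t 0 k) ^+ 2.
  transitivity (\sum_k (q - p) 0 k ^+ 2).
    by apply: eq_bigr => k _; rewrite !mxE -sqrrN opprB.
  rewrite -(rotation_sqnorm _ (Qr t t01)); apply: eq_bigr => k _.
  by rewrite /P /P' /rigid_motion mulmxBl !mxE; congr (_ ^+ 2); ring.
rewrite sum_ord3 lerD// -[leLHS]real_normK ?num_real// lerXn2r ?nnegrE//; first lra.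
by rewrite ler_norml; apply/andP; split; lra.
Qed.

(** * Segments of arbitrary length pushed through the door *)

Lemma affine_continuous (R : realType) (a b : R) : continuous (fun t => a * t + b).
Proof.
move=> t; apply: (@continuousD _ _ _ ( *%R a) (fun=> b)); first exact: mulrl_continuous.
exact: cst_continuous.
Qed.

Definition row3 (R : nmodType) (x y z : R) : 'rV[R]_3 := \row_j nth 0 [:: x; y; z] j.

Lemma row3_continuous (R : realType) (T : topologicalType) (x y z : T -> R) :
  continuous x -> continuous y -> continuous z ->
  continuous (fun t => row3 (x t) (y t) (z t)).
Proof.
move=> xc yc zc; apply: mx_continuous => i; elim/ord3_ind.
- by under eq_fun do rewrite mxE.
- by under eq_fun do rewrite mxE.
- by under eq_fun do rewrite mxE.
Qed.

(** The rotation is constant: the segment is made parallel to [u] and slid along its own line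
    through the door centre [m]. With [sg] equal to 1 this line rises from the first half into the
    second, with -1 it falls. *)
Lemma moves_through_door (R : realType) (a b c sg : R) (i : 'I_2) (j : 'I_4) (p q : 'rV[R]_3) :
  0 < a -> 0 < b -> 0 < c -> sg ^+ 2 = 1 ->
  (forall x r, 0 < x < a -> 0 <= r -> planarA a b i (x, b / 2 - sg * r)) ->
  (forall x r, a < x -> 0 <= r -> planarB a b j (x, b / 2 + sg * r)) ->
  planarB a b j (a, b / 2) ->
  p != q -> moves_around_corner a b c i j (line_segment p q).
Proof.
move=> a0 b0 c0 sg1 hA hB hD pq.
pose d2 := \sum_k (q - p) 0 k ^+ 2.
have d20 : 0 < d2.
  rewrite lt_def sumr_ge0 ?andbT => [|k _]; last exact: sqr_ge0.
  apply: contra pq => /eqP; rewrite /d2 sum_ord3 => /eqP.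
  rewrite !paddr_eq0 ?addr_ge0 ?sqr_ge0// !sqrf_eq0 !mxE !subr_eq0.
  move=> /andP[/andP[/eqP h0 /eqP h1] /eqP h2].
  by apply/eqP/matrixP => k l; rewrite ord1; elim/ord3_ind : l.
(* Points of the moving segment are [m + r *: u] with [r] at least -3/2, so [e <= a / 2] keeps x at
   least a/4. The other bound lets [u] have the length of the segment. *)
pose e := Num.min (a / 2) (Num.sqrt d2).
have e0 : 0 < e by rewrite lt_min sqrtr_gt0 d20 divr_gt0.
have ea : e <= a / 2 by rewrite ge_min lexx.
have ed : e ^+ 2 <= d2.
  rewrite -[leRHS](sqr_sqrtr (ltW d20)) lerXn2r ?nnegrE ?sqrtr_ge0 ?(ltW e0)//.
  by rewrite ge_min lexx orbT.
pose n := Num.sqrt (d2 - e ^+ 2).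
have n0 : 0 <= n by exact: sqrtr_ge0.
pose u := row3 e (sg * n) 0.
have uE : \sum_k (q - p) 0 k ^+ 2 = \sum_k u 0 k ^+ 2.
  rewrite [RHS]sum_ord3 !mxE /= exprMn sg1 sqr_sqrtr ?subr_ge0// -/d2; ring.
have [Q Qr dQ] := rotation_align uE.
pose m := row3 a (b / 2) (c / 2).
(* The midpoint of the segment travels from [m - u] to [m + u]. *)
pose v (t : R) := m + (2 * t - 1) *: u - 2^-1 *: ((p + q) *m Q).
have pointE t s : 0 <= t <= 1 -> 0 <= s <= 1 -> exists r,
    [/\ rigid_motion Q (v t) ((1 - s) *: p + s *: q) = m + r *: u,
        - (3 / 2) <= r, t = 0 -> r < 0 & t = 1 -> 0 < r].
  move=> t01 s01; pose r0 := s - 2^-1.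
  have -> : rigid_motion Q (v t) ((1 - s) *: p + s *: q) =
      m + (2 * t - 1) *: u + r0 *: ((q - p) *m Q).
    apply/matrixP => k l; rewrite /rigid_motion /v !mulmxDl !mulNmx -!scalemxAl !mxE /r0.
    by field.
  case: dQ => ->; [exists (2 * t - 1 + r0)|exists (2 * t - 1 - r0)]; split.
  - by apply/matrixP => k l; rewrite !mxE; ring.
  - by rewrite /r0; lra.
  - by rewrite /r0 => ->; lra.
  - by rewrite /r0 => ->; lra.
  - by apply/matrixP => k l; rewrite !mxE; ring.
  - by rewrite /r0; lra.
  - by rewrite /r0 => ->; lra.
  - by rewrite /r0 => ->; lra.
have inA r : - (3 / 2) <= r -> r < 0 -> prism (planarA a b i) c (m + r *: u).
  move=> r1 r0; split; rewrite !mxE /=; last lra.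
  rewrite (_ : b / 2 + _ = b / 2 - sg * (- r * n)); last by ring.
  apply: hA; last by apply: mulr_ge0 => //; lra.
  by apply/andP; split; nra.
have inB r : 0 <= r -> prism (planarB a b j) c (m + r *: u).
  move=> r0; split; rewrite !mxE /=; last lra.
  have [->|rn0] := eqVneq r 0; first by rewrite !mul0r !addr0.
  rewrite (_ : r * (sg * n) = sg * (r * n)); last by ring.
  apply: hB; last by rewrite mulr_ge0.
  by rewrite ltrDl mulr_gt0// lt_def rn0.
exists (fun=> Q), v; split => //.
- split; apply: continuous_subspaceT; first by move=> ?; exact: cst_continuous.
  apply: mx_continuous => k l; set w := 2^-1 *: _ in v {pointE} *.
  rewrite (_ : (fun t => v t k l) =
    (fun t => 2 * u k l * t + (m k l - u k l - w k l))); first exact: affine_continuous.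
  by apply/funext => t; rewrite !mxE; ring.
- move=> _ [_ [s s01 <-] <-]; rewrite /= in_itv/= in s01.
  have [||r [-> r1 r0 _]] := pointE 0 s; rewrite ?lexx ?ler01//.
  by apply: inA => //; exact: r0.
- move=> _ [_ [s s01 <-] <-]; rewrite /= in_itv/= in s01.
  have [||r [-> _ _ r0]] := pointE 1 s; rewrite ?lexx ?ler01//.
  by apply: inB; apply/ltW/r0.
move=> t t01 _ [_ [s s01 <-] <-]; rewrite /= in_itv/= in s01.
have [||r [-> r1 _ _]] := pointE t s; rewrite ?lexx ?ler01//.
have [r0|r0] := ltP r 0.
  by have [? ?] := inA r r1 r0; split => //; left.
by have [? ?] := inB r r0; split => //; right.
Qed.

(** * Turning a slightly shortened ladder around the corner *)

Lemma max_affine_continuous (R : realType) (a b : R) :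
  continuous (fun t => Num.max (a * t + b) 0).
Proof.
move=> t; have := @continuous_max R R (fun t => a * t + b) (fun=> 0) t; apply.
  exact: affine_continuous.
exact: cst_continuous.
Qed.

Lemma add_scale_continuous (R : realType) (a b : R) (f : R -> R) :
  continuous f -> continuous (fun t => b + a * f t).
Proof.
move=> fc t; apply: (@continuousD _ _ _ (fun=> b) (fun t => a * f t)).
  exact: cst_continuous.
by apply: continuousM; [exact: cst_continuous|exact: fc].
Qed.

(** Acting on row vectors, it sends the first axis to (C, -S, 0), so a segment from the origin along
    that axis is tilted downwards. *)
Definition horizontal_rotation (R : pzRingType) (C S : R) : 'M[R]_3 :=
  \matrix_(i, j) nth 0 (nth [::] [:: [:: C; - S; 0]; [:: S; C; 0]; [:: 0; 0; 1]] i) j.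

Lemma horizontal_rotationP (R : realType) (C S : R) : C ^+ 2 + S ^+ 2 = 1 ->
  rotation (horizontal_rotation C S).
Proof.
move=> CS; split; last by rewrite det3 !mxE /= -[RHS]CS; ring.
apply/matrixP; elim/ord3_ind; elim/ord3_ind; rewrite !mxE sum_ord3 !mxE /=.
all: first [ring|by rewrite -[RHS]CS; ring].
Qed.

Lemma horizontal_rotation_continuous (R : realType) (T : topologicalType) (C S : T -> R) :
  continuous C -> continuous S -> continuous (fun t => horizontal_rotation (C t) (S t)).
Proof.
move=> Cc Sc; apply: mx_continuous.
elim/ord3_ind; elim/ord3_ind; under eq_fun do rewrite mxE /=.
all: try exact: cst_continuous.
all: try by [].
by move=> t; apply: continuousN; exact: Sc.
Qed.

(** The ladder keeps its ends at distance [de] from the outer walls. In [ladder_ineq] scaled by [k],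
    the hypothesis on x absorbs the term [k * al ^+ 3 * S], and dividing by [C] bounds the height;
    [C = 0] would force x = [de], which is less than a. *)
Lemma ladder_position (R : realFieldType) (al be M k de C S s : R) :
  0 <= al -> 0 <= be -> 0 <= M -> M ^+ 2 = al ^+ 2 + be ^+ 2 -> 0 <= k ->
  k * al ^+ 3 < al ^+ 3 - de -> k * be ^+ 3 < be ^+ 3 - de ->
  0 <= C -> 0 <= S -> C ^+ 2 + S ^+ 2 = 1 ->
  al ^+ 3 <= de + s * (k * M ^+ 3) * C ->
  de + (1 - s) * (k * M ^+ 3) * S < be ^+ 3.
Proof.
move=> al0 be0 M0 M2 k0 kal kbe C0 S0 CS hx.
have hyp := ler_wpM2l k0 (ladder_ineq al0 be0 M0 M2 C0 S0 CS).
have Cn0 : C != 0.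
  apply/eqP => CE; move: hx; rewrite CE mulr0 addr0 leNgt => /negP; apply.
  by rewrite -subr_gt0 (le_lt_trans _ kal)// mulr_ge0 ?exprn_ge0.
have Cp : 0 < C by rewrite lt_def Cn0.
have hS : k * al ^+ 3 * S <= s * (k * M ^+ 3) * C * S by rewrite ler_wpM2r//; lra.
suff : (1 - s) * (k * M ^+ 3) * S <= k * be ^+ 3 by lra.
rewrite -(ler_pM2r Cp).
have -> : (1 - s) * (k * M ^+ 3) * S * C =
  k * (M ^+ 3 * C * S) - s * (k * M ^+ 3) * C * S by ring.
lra.
Qed.

Lemma movable_scaled_length (R : realType) (al be M c k : R) (i : 'I_2) (j : 'I_4) :
  val i = 1%N -> val j = 3%N ->
  0 < al -> 0 < be -> 0 < M -> M ^+ 2 = al ^+ 2 + be ^+ 2 -> 0 < c -> 0 < k < 1 ->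
  movable_segment_lengths (al ^+ 3) (be ^+ 3) c i j
    (k * Num.sqrt ((al ^+ 2 + be ^+ 2) ^+ 3 + c ^+ 2)).
Proof.
move=> iE jE al0 be0 M0 M2 c0 /andP[k0 k1].
have a0 : 0 < al ^+ 3 by rewrite exprn_gt0.
have b0 : 0 < be ^+ 3 by rewrite exprn_gt0.
have kM0 : 0 < k * M ^+ 3 by rewrite mulr_gt0 ?exprn_gt0.
(* Half of the slack that the factor [k] leaves at the narrower of the two walls. *)
pose de := (1 - k) / 2 * Num.min (al ^+ 3) (be ^+ 3).
have k2 : 0 < (1 - k) / 2 by lra.
have de0 : 0 < de by rewrite mulr_gt0// lt_min a0.
have dea : de <= (1 - k) / 2 * al ^+ 3 by rewrite ler_pM2l// ge_min lexx.
have deb : de <= (1 - k) / 2 * be ^+ 3 by rewrite ler_pM2l// ge_min lexx orbT.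
have kal : k * al ^+ 3 < al ^+ 3 - de by nra.
have kbe : k * be ^+ 3 < be ^+ 3 - de by nra.
have ka0 : 0 < k * al ^+ 3 by rewrite mulr_gt0.
have kb0 : 0 < k * be ^+ 3 by rewrite mulr_gt0.
have kc0 : 0 < k * c by rewrite mulr_gt0.
have kc1 : k * c < c by rewrite gtr_pMl.
pose q := row3 (k * M ^+ 3) 0 (k * c).
exists 0, q; split.
  apply/negP => /eqP /matrixP /(_ 0 0); rewrite !mxE /= => h.
  by move: kM0; rewrite -h ltxx.
split.
  rewrite /euclidean_dist sum_ord3 !mxE /= -[k in LHS](gtr0_norm k0) -sqrtr_sqr -sqrtrM ?sqr_ge0//.
  by congr Num.sqrt; rewrite -M2; ring.
(* The angle falls from pi/2 to 0 up to time 1/2 and then rests; the push [e] rests until time 1/2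
   and then grows to 1. *)
pose th (t : R) := Num.max ((- pi) * t + pi / 2) 0.
pose e (t : R) := Num.max (2 * t + - 1) 0.
have th_cont : continuous th by exact: max_affine_continuous.
have e_cont : continuous e by exact: max_affine_continuous.
pose C t := cos (th t); pose S t := sin (th t).
have C_cont : continuous C.
  by move=> t; apply: continuous_comp; [exact: th_cont|exact: continuous_cos].
have S_cont : continuous S.
  by move=> t; apply: continuous_comp; [exact: th_cont|exact: continuous_sin].
have CS t : C t ^+ 2 + S t ^+ 2 = 1 by rewrite /C /S cos2Dsin2.
have pi0 := pi_gt0 R.
have thI t : 0 <= t <= 1 -> 0 <= th t <= pi / 2.
  move=> /andP[t0 _]; rewrite /th le_max lexx orbT ge_max /=.
  by rewrite gerDr mulNr oppr_le0 mulr_ge0 ?divr_ge0 ?(ltW pi0).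
have C0 t : 0 <= t <= 1 -> 0 <= C t.
  move=> /thI h; apply: cos_ge0_pihalf.
  by apply/andP; split; lra.
have S0 t : 0 <= t <= 1 -> 0 <= S t.
  move=> /thI h; apply: sin_ge0_pi.
  by apply/andP; split; lra.
have e0 t : 0 <= e t by rewrite le_max lexx orbT.
have eS t : e t = 0 \/ S t = 0 /\ C t = 1.
  rewrite /e /S /C /th; have [t2|t2] := leP t 2^-1.
    by left; apply/max_idPr; lra.
  right; suff -> : Num.max (- pi * t + pi / 2) 0 = 0 :> R by rewrite sin0 cos0.
  by apply/max_idPr; nra.
(* The first end stays at distance [de] from the left wall until it is pushed by a, the second end
   stays at height [de], and the vertical slack is split equally. *)
pose v t := row3 (de + al ^+ 3 * e t) (de + k * M ^+ 3 * S t) ((c - k * c) / 2).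
have pointE t s : rigid_motion (horizontal_rotation (C t) (S t)) (v t)
    ((1 - s) *: 0 + s *: q) =
    row3 (de + al ^+ 3 * e t + s * (k * M ^+ 3) * C t)
      (de + (1 - s) * (k * M ^+ 3) * S t) (s * (k * c) + (c - k * c) / 2).
  rewrite /rigid_motion; apply/matrixP => x y; rewrite ord1 !mxE sum_ord3 !mxE.
  by elim/ord3_ind : y => /=; ring.
have zP s : 0 <= s <= 1 -> 0 < s * (k * c) + (c - k * c) / 2 < c.
  by move=> s01; apply/andP; split; nra.
have inA t s : 0 <= t <= 1 -> 0 <= s <= 1 ->
    de + al ^+ 3 * e t + s * (k * M ^+ 3) * C t < al ^+ 3 ->
    planarA (al ^+ 3) (be ^+ 3) i (de + al ^+ 3 * e t + s * (k * M ^+ 3) * C t,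
      de + (1 - s) * (k * M ^+ 3) * S t).
  move=> t01 /andP[s0 s1] h; rewrite /planarA iE; split => /=; [right => /=|].
    rewrite h andbT -addrA ltr_pwDl// addr_ge0// mulr_ge0 ?C0 ?(ltW a0)//.
    by rewrite mulr_ge0// ltW.
  by rewrite ltr_pwDl// mulr_ge0 ?S0// mulr_ge0 ?subr_ge0// ltW.
have inB t s : 0 <= t <= 1 -> 0 <= s <= 1 ->
    al ^+ 3 <= de + al ^+ 3 * e t + s * (k * M ^+ 3) * C t ->
    planarB (al ^+ 3) (be ^+ 3) j (de + al ^+ 3 * e t + s * (k * M ^+ 3) * C t,
      de + (1 - s) * (k * M ^+ 3) * S t).
  move=> t01 /andP[s0 s1] h; rewrite /planarB jE.
  have y0 : 0 < de + (1 - s) * (k * M ^+ 3) * S t.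
    by rewrite ltr_pwDl// mulr_ge0 ?S0// mulr_ge0 ?subr_ge0// ltW.
  have yb : de + (1 - s) * (k * M ^+ 3) * S t < be ^+ 3.
    (* Before the push [ladder_position] applies; during it the whole ladder has y-coordinate
       [de]. *)
    have [et|[-> _]] := eS t; last by lra.
    rewrite et mulr0 addr0 in h.
    exact: ladder_position (ltW al0) (ltW be0) (ltW M0) M2 (ltW k0) kal kbe
      (C0 t t01) (S0 t t01) (CS t) h.
  split; last by rewrite /= y0.
  by move: h; rewrite le_eqVlt => /predU1P[xE|]; [left; split => /=; rewrite -?xE ?y0|right].
have seg t (X : set 'rV[R]_3) :
    (forall s, 0 <= s <= 1 -> X (row3 (de + al ^+ 3 * e t + s * (k * M ^+ 3) * C t)
      (de + (1 - s) * (k * M ^+ 3) * S t) (s * (k * c) + (c - k * c) / 2))) ->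
    rigid_motion (horizontal_rotation (C t) (S t)) (v t) @` line_segment 0 q `<=` X.
  move=> h _ [_ [s s01 <-] <-]; rewrite pointE; apply: h.
  by move: s01; rewrite /= in_itv.
exists (fun t => horizontal_rotation (C t) (S t)), v; split.
- split; apply: continuous_subspaceT; first exact: horizontal_rotation_continuous.
  apply: row3_continuous; last by move=> ?; exact: cst_continuous.
    exact: add_scale_continuous.
  exact: add_scale_continuous.
- by move=> t _; exact: horizontal_rotationP.
- apply: seg => s s01; split; rewrite !mxE /=; last exact: zP.
  apply: inA => //; first by rewrite lexx ler01.
  have -> : e 0 = 0 by rewrite /e mulr0 add0r; apply/max_idPr; lra.
  have -> : C 0 = 0.
    by rewrite /C /th mulr0 add0r (max_idPl _) ?cos_pihalf// divr_ge0 ?(ltW pi0).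
  lra.
- have t01 : 0 <= (1 : R) <= 1 by rewrite lexx ler01.
  apply: seg => s s01; split; rewrite !mxE /=; last exact: zP.
  apply: inB => //; case/andP: s01 => s0 s1.
  have -> : e 1 = 1 by rewrite /e mulr1 (max_idPl _) //; lra.
  have : 0 <= s * (k * M ^+ 3) * C 1 by rewrite mulr_ge0 ?C0// mulr_ge0// ltW.
  lra.
move=> t t01; apply: seg => s s01; split; rewrite !mxE /=; last exact: zP.
by have [h|h] := ltP (de + al ^+ 3 * e t + s * (k * M ^+ 3) * C t) (al ^+ 3);
  [left; exact: inA|right; exact: inB].
Qed.

(** * The supremum and the distribution over the eight corridors *)

Lemma sup_scaled_elements (R : realType) (E : set R) (L : R) : 0 < L -> ubound E L ->
  (forall k, 0 < k < 1 -> E (k * L)) -> has_sup E /\ sup E = L.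
Proof.
move=> L0 ubL EL.
have sE : has_sup E.
  by split; [exists (2^-1 * L); apply: EL; lra|exists L].
split => //; apply/eqP; rewrite eq_le ge_sup//=; last by case: sE.
have ubE x : E x -> x <= sup E by exact: sup_upper_bound.
have sup0 : 0 < sup E.
  have /ubE : E (2^-1 * L) by apply: EL; lra.
  by apply: lt_le_trans; rewrite mulr_gt0.
rewrite leNgt; apply/negP => supL.
(* Chosen so that [k * L] is the midpoint of [sup E] and [L], an element above the supremum. *)
pose k := (sup E / L + 1) / 2.
have kE : k * L = (sup E + L) / 2 by rewrite /k; field; rewrite gt_eqF.
have q0 : 0 < sup E / L by rewrite divr_gt0.
have q1 : sup E / L < 1 by rewrite ltr_pdivrMr// mul1r.
have /ubE : E (k * L) by apply: EL; rewrite /k; lra.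
by rewrite kE; lra.
Qed.

Lemma planarB3_sub (R : realType) (a b : R) (j j' : 'I_4) :
  val j = 3%N -> planarB a b j `<=` planarB a b j'.
Proof.
rewrite /planarB => -> z [B0 /andP[z0 zb]].
by case: (val j') => [|[|[|_]]] //=; split => //=; rewrite z0.
Qed.

Lemma movable_segment_lengths_mono (R : realType) (a b c : R) (i i' : 'I_2) (j j' : 'I_4) :
  planarA a b i `<=` planarA a b i' -> planarB a b j `<=` planarB a b j' ->
  movable_segment_lengths a b c i j `<=` movable_segment_lengths a b c i' j'.
Proof.
move=> AA BB l [p [q [pq [lE m]]]]; exists p, q; split=> //; split=> //.
exact: moves_around_corner_mono m.
Qed.

(** Writing a and b as cubes keeps the argument polynomial in [al] and [be]. *)
Lemma longest_segment_length_cube (R : realType) (al be c : R) (i : 'I_2) (j : 'I_4) :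
  0 < al -> 0 < be -> 0 < c -> (val i, val j) \in [:: (0, 3); (1, 1); (1, 3)]%N ->
  longest_segment_length (al ^+ 3) (be ^+ 3) c i j
    (Num.sqrt ((al ^+ 2 + be ^+ 2) ^+ 3 + c ^+ 2)).
Proof.
move=> al0 be0 c0 ij.
have D0 : 0 < al ^+ 2 + be ^+ 2 by rewrite addr_gt0 ?exprn_gt0.
have X0 : 0 < (al ^+ 2 + be ^+ 2) ^+ 3 + c ^+ 2 by rewrite addr_gt0 ?exprn_gt0.
pose i1 := @Ordinal 2 1 isT; pose j1 := @Ordinal 4 1 isT; pose j3 := @Ordinal 4 3 isT.
apply: sup_scaled_elements; first by rewrite sqrtr_gt0.
- suff sq l : movable_segment_lengths (al ^+ 3) (be ^+ 3) c i j l ->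
      l ^+ 2 <= (al ^+ 2 + be ^+ 2) ^+ 3 + c ^+ 2.
    move=> l lm; case: (lm) => p [q [_ [lE _]]].
    have l0 : 0 <= l by rewrite lE sqrtr_ge0.
    by rewrite -(@ler_pXn2r _ 2) ?nnegrE ?sqrtr_ge0// (sqr_sqrtr (ltW X0)) sq.
  move: ij; rewrite !inE => /or3P[] /eqP ijE; try
    by apply: movable_length_sqr_le => //; rewrite ijE.
  case: ijE => iE jE.
  (* S_13 is contained in S_11 and inherits its upper bound. *)
  move=> lm; apply: (@movable_length_sqr_le _ _ _ _ i1 j1) => //.
  apply: movable_segment_lengths_mono lm; last exact: planarB3_sub.
  by apply: planarA_mono; rewrite iE.
(* S_13 is contained in each of the three corridors, so its segments give all the lower bounds. *)
- move=> k k01; have := @movable_scaled_length _ al be (Num.sqrt (al ^+ 2 + be ^+ 2)) c k i1 j3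
    erefl erefl al0 be0 _ _ c0 k01.
  rewrite sqrtr_gt0 sqr_sqrtr ?ltW// => /(_ D0 erefl).
  apply: movable_segment_lengths_mono; last exact: planarB3_sub.
  by apply: planarA_mono; rewrite -ltnS; exact: (ltn_ord i).
Qed.

Lemma moves_any_length (R : realType) (a b c : R) (i : 'I_2) (j : 'I_4) (p q : 'rV[R]_3) :
  0 < a -> 0 < b -> 0 < c ->
  (val i, val j) \in [:: (0, 0); (0, 1); (0, 2); (1, 0); (1, 2)]%N ->
  p != q -> moves_around_corner a b c i j (line_segment p q).
Proof.
move=> a0 b0 c0 ij; have [/eqP|ijN] := boolP ((val i, val j) == (0, 1)%N).
  move=> [iE jE]; have {}iE : val i = 0%N by []; have {}jE : val j = 1%N by [].
  (* In S_01 the first half is unbounded downwards and the second upwards. *)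
  apply: (@moves_through_door _ _ _ _ 1) => //; first by rewrite expr1n.
  - by move=> x r xa r0; rewrite /planarA iE; right.
  - by move=> x r ax r0; rewrite /planarB jE; split; [right|rewrite /=; lra].
  - by rewrite /planarB jE; split; [left; split => //=|rewrite /=]; lra.
have {ij ijN}jE : val j = 0%N \/ val j = 2%N.
  move: ij; rewrite in_cons in_cons (negbTE ijN) !inE /= => /or4P[] /eqP[_ ?];
    by [left|right].
(* In the other four corridors the first half is unbounded upwards and the second downwards. *)
apply: (@moves_through_door _ _ _ _ (-1)) => //; first by rewrite sqrrN expr1n.
- move=> x r xa r0; apply: (@planarA_mono _ _ _ (@Ordinal 2 1 isT)).
    by rewrite -ltnS; exact: (ltn_ord i).
  by rewrite /planarA /=; split; [right|rewrite /=; lra].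
- move=> x r ax r0; rewrite /planarB.
  by case: jE => ->; [right|split; [right|rewrite /=; lra]].
rewrite /planarB.
by case: jE => ->; [left|split; [left|]]; try split; rewrite //=; lra.
Qed.

Theorem corollary5 (R : realType) (a b c : R)
    (ha : 0 < a) (hb : 0 < b) (hc : 0 < c) :
  (forall (i : 'I_2) (j : 'I_4),
     (val i, val j) \in [:: (0, 3); (1, 1); (1, 3)]%N ->
     longest_segment_length a b c i j
       (((a `^ (2 / 3) + b `^ (2 / 3)) ^+ 3 + c ^+ 2) `^ (1 / 2))) /\
  (forall (i : 'I_2) (j : 'I_4),
     (val i, val j) \in [:: (0, 0); (0, 1); (0, 2); (1, 0); (1, 2)]%N ->
     forall p q : 'rV[R]_3, p != q ->
       moves_around_corner a b c i j (line_segment p q)).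
Proof.
split=> [i j ij|i j ij p q pq]; last exact: moves_any_length.
(* The cube roots of a and b serve as [al] and [be], and the powers 2/3 become their squares. *)
have cube (x : R) : 0 < x -> x = (x `^ 3^-1) ^+ 3.
  by move=> x0; rewrite -powR_mulrn ?powR_ge0// -powRrM mulVf// powRr1// ltW.
have sqr (x : R) : x `^ (2 / 3) = (x `^ 3^-1) ^+ 2.
  by rewrite -powR_mulrn ?powR_ge0// -powRrM mulrC.
rewrite !sqr div1r powR12_sqrt ?addr_ge0 ?exprn_ge0 ?addr_ge0 ?sqr_ge0 ?(ltW hc)//.
rewrite [X in longest_segment_length X](cube _ ha) [X in longest_segment_length _ X](cube _ hb).
by apply: longest_segment_length_cube; rewrite ?powR_gt0.
Qed.
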